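(* (i) Let $(\mathcal{V},\mathcal{L})$ be a line transitive partial linear space, and suppose that $G$ is a group of permutations of $\mathcal{V}$ which preserves and acts transitively on $\mathcal{L}$. Let $\Gamma$ be the graph with vertex set $\mathcal{V}$ and edges $\{\alpha,\beta\}$ whenever there exists $\ell\in\mathcal{L}$ with $\alpha$ and $\beta$ both in $\ell$. For each $\ell\in\mathcal{L}$, let $P_\ell$ be the set of all unordered pairs of distinct elements of $\ell$, and let $\mathcal{P}=\{P_\ell \mid \ell\in\mathcal{L}\}$. Then $(\Gamma,\mathcal{P})$ is a $G$-transitive decomposition, and each $\Gamma_{P_\ell}$ is a complete subgraph of $\Gamma$. (ii) Let $(\Gamma,\mathcal{P})$ be a $G$-transitive decomposition such that for each $P\in\mathcal{P}$, the subgraph $\Gamma_P$ is a complete subgraph of $\Gamma$. Let $\mathcal{V}=V\Gamma$, and let $\mathcal{L}=\{V\Gamma_P \mid P\in\mathcal{P}\}$. Then $(\mathcal{V},\mathcal{L})$ is a line transitive partial linear space.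
   Context: For a graph $\Gamma$, $V\Gamma$ and $E\Gamma$ denote its vertex set and edge set, an edge being an unordered pair of vertices. Let $\Gamma$ be a graph, $\mathcal{P}$ a partition of $E\Gamma$, and $G$ a group of automorphisms of $\Gamma$ (a group of permutations of $V\Gamma$ which leaves $E\Gamma$ invariant). The pair $(\Gamma,\mathcal{P})$ is called a $G$-transitive decomposition if (1) given any part $P$ in $\mathcal{P}$ and any automorphism in $G$, $P$ is mapped by the automorphism either wholly to itself or wholly to a different part in $\mathcal{P}$; and (2) given any two parts in $\mathcal{P}$, there exists an automorphism in $G$ mapping the first wholly to the second. For $P\in\mathcal{P}$, $\Gamma_P$ is the subgraph of $\Gamma$ whose edge set is $P$ and whose vertex set $V\Gamma_P$ consists of those vertices of $\Gamma$ incident with edges in $P$. A graph is complete if every pair of its vertices is an edge. A partial linear space $(\mathcal{V},\mathcal{L})$ is a set $\mathcal{V}$ of points together with a set $\mathcal{L}$ of (at least two) lines, where each line is a subset of points, and every pair of points lies in at most one line. It is line transitive if there is a group of permutations of the points which preserves and transitively permutes the lines. (A group $G$ is transitive on a set $\Omega$ if for all $\omega,\omega'\in\Omega$ there is an element of $G$ mapping $\omega$ to $\omega'$.)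
   Formalization: In (i) Γ is assumed to have at least one edge (otherwise every P_ℓ is empty and 𝒫 is not a partition into nonempty parts); in (ii) 𝒫 is assumed to have at least two parts (otherwise there are fewer than two lines, e.g. Γ = K_2 with one part). *)

(* Defs.v *)
From mathcomp Require Import all_boot.
From mathcomp Require Import boolp classical_sets.

Set Implicit Arguments.
Unset Strict Implicit.
Unset Printing Implicit Defensive.

Local Open Scope classical_set_scope.

Section Defs.
Variable T : Type.
Implicit Types (V A B : set T) (E P : set (set T)) (G : set (T -> T)).

Definition pairs A : set (set T) :=
  [set e | exists a b, [/\ A a, A b, a <> b & e = [set a; b]]].

(* As with [perm_on], a permutation of [V] is a bijection of the ambient type
   that fixes every point outside [V]. *)
Definition permutation_of V (g : T -> T) : Prop :=
  bijective g /\ forall x, ~ V x -> g x = x.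

Definition permutation_group V G : Prop :=
  [/\ forall g, G g -> permutation_of V g,
      G id,
      forall g h, G g -> G h -> G (g \o h) &
      forall g, G g -> exists h, [/\ G h, cancel g h & cancel h g]].

Definition preserves G (F : set (set T)) : Prop :=
  forall g, G g -> [set g @` A | A in F] = F.

Definition transitive_on G (F : set (set T)) : Prop :=
  forall A B, F A -> F B -> exists2 g, G g & g @` A = B.

Record graph := Graph { vertices : set T; edges : set (set T) }.

Definition is_graph (Gamma : graph) : Prop :=
  edges Gamma `<=` pairs (vertices Gamma).

Definition complete (Gamma : graph) : Prop :=
  forall a b, vertices Gamma a -> vertices Gamma b -> a <> b ->
  edges Gamma [set a; b].

Definition subgraph (Delta Gamma : graph) : Prop :=
  [/\ is_graph Delta, vertices Delta `<=` vertices Gamma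
    & edges Delta `<=` edges Gamma].

Definition complete_subgraph (Delta Gamma : graph) : Prop :=
  subgraph Delta Gamma /\ complete Delta.

Definition automorphism_group (Gamma : graph) G : Prop :=
  permutation_group (vertices Gamma) G /\ preserves G (edges Gamma).

Definition part_graph P : graph :=
  Graph [set v | exists2 e, P e & e v] P.

Definition transitive_decomposition (Gamma : graph) (PP : set (set (set T))) G
    : Prop :=
  [/\ is_graph Gamma,
      partition PP id (edges Gamma),
      automorphism_group Gamma G,
      forall P g, PP P -> G g -> PP [set g @` e | e in P] &
      forall P Q, PP P -> PP Q -> exists2 g, G g & [set g @` e | e in P] = Q].

Definition partial_linear_space V (L : set (set T)) : Prop :=
  [/\ forall l, L l -> l `<=` V,
      exists l m, [/\ L l, L m & l <> m] &
      forall a b, V a -> V b -> a <> b ->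
      forall l m, L l -> L m -> l a -> l b -> m a -> m b -> l = m].

Definition line_transitive_pls V (L : set (set T)) : Prop :=
  partial_linear_space V L /\
  exists G, [/\ permutation_group V G, preserves G L & transitive_on G L].

Definition collinearity_graph V (L : set (set T)) : graph :=
  Graph V [set e | exists a b, [/\ V a, V b, a <> b, e = [set a; b]
                                 & exists l, [/\ L l, l a & l b]]].

End Defs.

(* Main.v *)
Require Import Defs.
From mathcomp Require Import all_boot.
From mathcomp Require Import boolp classical_sets.
Local Open Scope classical_set_scope.

(** The two constructions are mutually inverse: a line [l] with at least two
    points is recovered as the set of vertices covered by its pairs [pairs l],
    and a part [P] spanning a complete subgraph is recovered as the set of all
    pairs of its vertices ([complete_edgesE]).  Both passages commute with
    injective maps ([image_pairs], [image_part_vertices]), so invariance and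
    transitivity of [G] on lines and on parts are the same thing.  Under this
    dictionary, two points lie on at most one line exactly when an edge lies in
    at most one part ([pls_pairs_inj] in one direction, [decomposition_pls] in
    the other).

    The degenerate case to exclude in the first construction is a line with at
    most one point, which would give an empty part.  Transitivity of [G] makes
    all lines equipollent, so a single edge of the collinearity graph rules it
    out. *)

Section LinesAndParts.
Local Set Implicit Arguments.
Local Unset Strict Implicit.
Context {T : Type}.
Implicit Types (V A l : set T) (E F P : set (set T)) (L : set (set T)).
Implicit Types (G : set (T -> T)) (g : T -> T) (Gamma : graph T).

Lemma image_set2 g a b : g @` [set a; b] = [set g a; g b].
Proof. by rewrite image_setU !image_set1. Qed.

Lemma pairs_sub A B : A `<=` B -> pairs A `<=` pairs B.
Proof.
by move=> AB e [a [b [Aa Ab ab ->]]]; exists a, b; split => //; apply: AB.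
Qed.

Lemma mem_pairs A e v : pairs A e -> e v -> A v.
Proof. by move=> [a [b [Aa Ab _ ->]]] [->|->]. Qed.

(** Injectivity keeps the two ends of a pair distinct. *)
Lemma image_pairs g A : injective g ->
  [set g @` e | e in pairs A] = pairs (g @` A).
Proof.
move=> g_inj; apply/seteqP; split => [_ [e [a [b [Aa Ab ab ->]]] <-]|].
  exists (g a), (g b); split; [by exists a|by exists b|by move/g_inj|].
  exact: image_set2.
move=> _ [_ [_ [[a Aa <-] [b Ab <-] ab ->]]].
exists [set a; b]; last exact: image_set2.
by exists a, b; split => // E; apply: ab; rewrite E.
Qed.

Lemma image_part_vertices g P :
  vertices (part_graph [set g @` e | e in P]) =
  g @` vertices (part_graph P).
Proof.
apply/seteqP; split => [_ [_ [e Pe <-] [v ev <-]]|_ [v [e Pe ev] <-]].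
  by exists v => //; exists e.
by exists (g @` e); [exists e|exists v].
Qed.

Lemma complete_edgesE Gamma : is_graph Gamma -> complete Gamma ->
  edges Gamma = pairs (vertices Gamma).
Proof.
move=> sub cpl; apply/seteqP; split => // e [a [b [Va Vb ab ->]]].
exact: cpl.
Qed.

Lemma part_graph_pairs_vertices A :
  vertices (part_graph (pairs A)) `<=` A.
Proof. by move=> v [e Ae ev]; apply: mem_pairs Ae ev. Qed.

Lemma part_graph_pairs_graph A : is_graph (part_graph (pairs A)).
Proof.
move=> e Ae; case: (Ae) => a [b [Aa Ab ab eE]].
exists a, b; split => //; exists e => //; rewrite eE; [by left|by right].
Qed.

Lemma part_graph_pairs_complete A : complete (part_graph (pairs A)).
Proof.
move=> a b /part_graph_pairs_vertices Aa /part_graph_pairs_vertices Ab ab.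
by exists a, b.
Qed.

Lemma permutation_group_inj V G g : permutation_group V G -> G g ->
  injective g.
Proof. by case=> perm _ _ _ /perm[/bij_inj]. Qed.

(** Closure under a whole group is invariance: the inverse of [g] supplies
    preimages. *)
Lemma preserves_closed V G F : permutation_group V G ->
  (forall g A, G g -> F A -> F (g @` A)) -> preserves G F.
Proof.
move=> [_ _ _ inv] cl g Gg; apply/seteqP; split => [_ [A FA <-]|A FA].
  exact: cl.
have [h [Gh _ hK]] := inv _ Gg.
exists (h @` A); first exact: cl.
by rewrite image_comp (_ : g \o h = id) ?image_id//; apply/funext.
Qed.

Lemma preserves_image G F g A : preserves G F -> G g -> F A -> F (g @` A).
Proof. by move=> pres Gg FA; rewrite -(pres _ Gg); exists A. Qed.

Lemma collinearity_edgesE V L : (forall l, L l -> l `<=` V) ->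
  edges (collinearity_graph V L) = \bigcup_(l in L) pairs l.
Proof.
move=> LV; apply/seteqP; split => e.
  by move=> [a [b [_ _ ab -> [l [Ll la lb]]]]]; exists l => //; exists a, b.
move=> [l Ll [a [b [la lb ab ->]]]]; exists a, b.
by split => //; [apply: LV la|apply: LV lb|exists l].
Qed.

(** A common pair of two lines is two common points. *)
Lemma pls_pairs_inj V L l m e : partial_linear_space V L ->
  L l -> L m -> pairs l e -> pairs m e -> l = m.
Proof.
move=> [LV _ uniq_line] Ll Lm [a [b [la lb ab eE]]] me.
have [ea eb] : e a /\ e b by rewrite eE; split; [left|right].
by apply: (uniq_line a b) => //;
  [exact: LV la|exact: LV lb|exact: mem_pairs ea|exact: mem_pairs eb].
Qed.

(** Parts are disjoint because a common pair determines the line, and nonempty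
    because [G] carries a pair inside one line into every other line. *)
Lemma pls_partition V L G : partial_linear_space V L ->
  (forall g, G g -> injective g) -> transitive_on G L ->
  edges (collinearity_graph V L) !=set0 ->
  partition [set pairs l | l in L] id (edges (collinearity_graph V L)).
Proof.
move=> pls inj trans; case: (pls) => LV _ _.
rewrite (collinearity_edgesE LV) => -[e [l Ll le]]; split.
- exact: bigcup_image.
- move=> _ _ [m Lm <-] [n Ln <-] [f [mf nf]].
  by rewrite (pls_pairs_inj pls Lm Ln mf nf).
- move=> _ [m Lm <-]; have [g Gg <-] := trans l m Ll Lm.
  by rewrite -image_pairs; [exists (g @` e), e|exact: inj].
Qed.

Lemma pls_transitive_decomposition V L G : partial_linear_space V L ->
  permutation_group V G -> preserves G L -> transitive_on G L ->
  edges (collinearity_graph V L) !=set0 ->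
  transitive_decomposition (collinearity_graph V L) [set pairs l | l in L] G.
Proof.
move=> pls grp pres trans edge; case: (pls) => LV _ _.
have inj g : G g -> injective g := permutation_group_inj grp.
have edgesE := collinearity_edgesE LV.
split.
- by rewrite /is_graph edgesE => e [l /LV lV] /(pairs_sub lV).
- exact: (pls_partition pls inj trans edge).
- split=> //; apply: preserves_closed grp _ => g e Gg.
  rewrite edgesE => -[l Ll le]; exists (g @` l).
    exact: (preserves_image pres).
  by rewrite -image_pairs; [exists e|exact: inj].
- move=> _ g [l Ll <-] Gg; exists (g @` l); first exact: (preserves_image pres).
  by rewrite image_pairs//; exact: inj.
- move=> _ _ [l Ll <-] [m Lm <-]; have [g Gg <-] := trans l m Ll Lm.
  by exists g => //; apply/image_pairs/inj.
Qed.

Lemma pls_complete_subgraph V L l : (forall l, L l -> l `<=` V) -> L l ->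
  complete_subgraph (part_graph (pairs l)) (collinearity_graph V L).
Proof.
move=> LV Ll; split; last exact: part_graph_pairs_complete.
split; first exact: part_graph_pairs_graph.
  by move=> v /part_graph_pairs_vertices; apply: LV.
by rewrite collinearity_edgesE// => e le; exists l.
Qed.

(** A complete part is determined by its vertex set, so two distinct parts give
    two distinct lines. *)
Lemma decomposition_pls Gamma (PP : set (set (set T))) :
  trivIset PP id -> (exists P Q, [/\ PP P, PP Q & P <> Q]) ->
  (forall P, PP P -> complete_subgraph (part_graph P) Gamma) ->
  partial_linear_space (vertices Gamma)
    [set vertices (part_graph P) | P in PP].
Proof.
move=> triv [P [Q [PPP PPQ PQ]]] cpl.
have partE R : PP R -> R = pairs (vertices (part_graph R)).
  by move=> /cpl[[gr _ _] c]; exact: (complete_edgesE gr c).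
split.
- by move=> _ [R /cpl[[_ sub _] _] <-].
- exists (vertices (part_graph P)), (vertices (part_graph Q)).
  split; [by exists P|by exists Q|move=> E].
  by apply: PQ; rewrite (partE P)// (partE Q)// E.
- move=> a b _ _ ab _ _ [R PPR <-] [S PPS <-] Ra Rb Sa Sb.
  (* Completeness puts the edge joining the two points in both parts. *)
  rewrite (triv R S)//; exists [set a; b]; split.
    by have [_] := cpl _ PPR; apply.
  by have [_] := cpl _ PPS; apply.
Qed.

Lemma decomposition_line_transitive Gamma (PP : set (set (set T))) G :
  transitive_decomposition Gamma PP G ->
  (exists P Q, [/\ PP P, PP Q & P <> Q]) ->
  (forall P, PP P -> complete_subgraph (part_graph P) Gamma) ->
  line_transitive_pls (vertices Gamma)
    [set vertices (part_graph P) | P in PP].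
Proof.
move=> [_ [_ triv _] [grp _] closed trans] two cpl.
split; first exact: decomposition_pls.
exists G; split => //.
  apply: preserves_closed grp _ => g _ Gg [P PPP <-].
  rewrite -image_part_vertices; exists [set g @` e | e in P] => //.
  exact: closed.
move=> _ _ [P PPP <-] [Q PPQ <-]; have [g Gg <-] := trans _ _ PPP PPQ.
by exists g; rewrite ?image_part_vertices.
Qed.

End LinesAndParts.

Theorem lemma2p1 (T : Type) :
  (forall (V : set T) (L : set (set T)) (G : set (T -> T)),
     line_transitive_pls V L ->
     permutation_group V G -> preserves G L -> transitive_on G L ->
     let Gamma := collinearity_graph V L in
     let PP := [set pairs l | l in L] in
     edges Gamma !=set0 ->
     transitive_decomposition Gamma PP G /\
     (forall l, L l -> complete_subgraph (part_graph (pairs l)) Gamma)) /\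
  (forall (Gamma : graph T) (PP : set (set (set T))) (G : set (T -> T)),
     transitive_decomposition Gamma PP G ->
     (exists P Q, [/\ PP P, PP Q & P <> Q]) ->
     (forall P, PP P -> complete_subgraph (part_graph P) Gamma) ->
     line_transitive_pls (vertices Gamma)
       [set vertices (part_graph P) | P in PP]).
Proof.
split=> [V L G [pls _] grp pres trans Gamma PP edge|Gamma PP G].
  split; first exact: pls_transitive_decomposition.
  by case: pls => LV _ _ l; apply: pls_complete_subgraph.
exact: decomposition_line_transitive.
Qed.
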